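(* Let $G$ be a finite $r$-locally chordal graph for an integer $r\ge 3$. Let $H$ be a subgraph of $\mathbf K(G)$. Then the following are equivalent: (i) $H$ is an $r$-acyclic clique graph of $G$. (ii) $H$ is a maximum weight $2$-acyclic spanning subgraph of $\mathbf K(G)$. (iii) $H$ is a $2$-acyclic spanning subgraph of $\mathbf K(G)$ of total weight $W(G):=\left(\sum_{K\in K(G)}|K|\right)-|V(G)|$.
   Context: Graphs are simple. The ball $B_{r/2}(v)$ is the subgraph of $G$ whose vertices are those at distance at most $r/2$ from $v$ and whose edges are the edges of $G$ for which the sum of the distances of the endpoints to $v$ is strictly less than $r$. A graph is chordal if each of its cycles of length at least $4$ has a chord; $G$ is $r$-locally chordal if every ball $B_{r/2}(v)$ is chordal. $K(G)$ is the set of inclusion-maximal cliques of $G$, $K_G(v)$ the set of those containing $v$, and $\mathbf K(G)$ the edge-weighted graph on $K(G)$ in which two distinct maximal cliques $K_1,K_2$ are adjacent iff $K_1\cap K_2\neq\emptyset$, the edge $K_1K_2$ having weight $|K_1\cap K_2|$. The total weight of a subgraph is the sum of the weights of its edges. For a spanning subgraph $H$ of $\mathbf K(G)$ and $v\in V(G)$ put $H_v=H[K_G(v)]$. A spanning subgraph $H$ of $\mathbf K(G)$ is $k$-acyclic if $\bigcup_{x\in X}H_x$ is acyclic for every $X\subseteq V(G)$ with $|X|\le k$. A maximum weight $k$-acyclic spanning subgraph of $\mathbf K(G)$ is a $k$-acyclic spanning subgraph having maximum total weight among all $k$-acyclic spanning subgraphs. A clique graph of $G$ is a spanning subgraph $H$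 of $\mathbf K(G)$ such that $H_v$ is connected for every vertex $v$ of $G$. *)

(* Defs.v *)
From mathcomp Require Import all_boot all_algebra.

Set Implicit Arguments.
Unset Strict Implicit.
Unset Printing Implicit Defensive.

(* A finite simple graph whose vertices live in an ambient finite type [T]:
   [verts] is an arbitrary subset of [T], and edges are unordered pairs, i.e.
   two-element subsets of [verts]. *)
Record sgraph (T : finType) := SGraph {
  verts : {set T};
  edges : {set {set T}};
  edges_wf : [forall e in edges, (#|e| == 2) && (e \subset verts)]
}.

Definition adj (T : finType) (G : sgraph T) : rel T :=
  fun x y => [set x; y] \in edges G.

Definition subgraph (T : finType) (H G : sgraph T) : Prop :=
  verts H \subset verts G /\ edges H \subset edges G.

Definition spanning_subgraph (T : finType) (H G : sgraph T) : Prop :=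
  subgraph H G /\ verts H = verts G.

Lemma graph_of_wf (T : finType) (V : {set T}) (R : rel T) :
  [forall e in [set e : {set T} | [exists x in V, exists y in V,
      [&& x != y, R x y & e == [set x; y]]]],
    (#|e| == 2) && (e \subset V)].
Proof.
apply/forall_inP => e; rewrite inE.
case/exists_inP => x xV /exists_inP[y yV /and3P[xy _ /eqP->]].
by rewrite cards2 xy subUset !sub1set xV yV.
Qed.

(* The graph on [V] in which distinct [x], [y] are adjacent iff [R x y] or
   [R y x]. *)
Definition graph_of (T : finType) (V : {set T}) (R : rel T) : sgraph T :=
  SGraph (graph_of_wf V R).

Lemma induced_wf (T : finType) (G : sgraph T) (X : {set T}) :
  [forall e in [set e in edges G | e \subset X],
    (#|e| == 2) && (e \subset verts G :&: X)].
Proof.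
apply/forall_inP => e; rewrite inE subsetI => /andP[eG ->].
by have /forall_inP/(_ e eG) := edges_wf G; rewrite andbT.
Qed.

Definition induced (T : finType) (G : sgraph T) (X : {set T}) : sgraph T :=
  SGraph (induced_wf G X).

Lemma bigunion_wf (I T : finType) (X : {set I}) (F : I -> sgraph T) :
  [forall e in \bigcup_(x in X) edges (F x),
    (#|e| == 2) && (e \subset \bigcup_(x in X) verts (F x))].
Proof.
apply/forall_inP => e /bigcupP[x xX ex].
have /forall_inP/(_ e ex)/andP[-> eV] := edges_wf (F x).
exact: subset_trans eV (bigcup_sup x xX).
Qed.

Definition bigunion (I T : finType) (X : {set I}) (F : I -> sgraph T) :
  sgraph T := SGraph (bigunion_wf X F).

Definition graph_connected (T : finType) (G : sgraph T) : Prop :=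
  verts G != set0 /\ {in verts G &, forall x y, connect (adj G) x y}.

(* A cycle is given by the cyclic sequence of its (pairwise distinct)
   vertices; its length is the size of the sequence. *)
Definition is_cycle (T : finType) (G : sgraph T) (c : seq T) : bool :=
  [&& 3 <= size c, uniq c & cycle (adj G) c].

Definition acyclic (T : finType) (G : sgraph T) : Prop :=
  forall c : seq T, ~~ is_cycle G c.

(* [next c x] is the successor of [x] along [c], so the last two conditions
   say that [xy] is not an edge of the cycle. *)
Definition has_chord (T : finType) (G : sgraph T) (c : seq T) : Prop :=
  exists x y : T,
    [/\ x \in c, y \in c, adj G x y, y != next c x & x != next c y].

Definition chordal (T : finType) (G : sgraph T) : Prop :=
  forall c : seq T, is_cycle G c -> 4 <= size c -> has_chord G c.

Definition walk (T : finType) (G : sgraph T) (x y : T) (n : nat) : bool :=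
  [exists p : n.-tuple T, path (adj G) x p && (last x p == y)].

Lemma connect_walk (T : finType) (G : sgraph T) (x y : T) :
  connect (adj G) x y -> exists n, walk G x y n.
Proof.
case/connectP => p xp ->; exists (size p).
by apply/existsP; exists (in_tuple p); rewrite xp eqxx.
Qed.

(* [None] stands for infinite distance. *)
Definition dist (T : finType) (G : sgraph T) (x y : T) : option nat :=
  if @idP (connect (adj G) x y) is ReflectT xy
  then Some (ex_minn (connect_walk xy)) else None.

Definition dist_le_half (T : finType) (G : sgraph T) (r : nat) (v x : T) :
  bool := if dist G v x is Some d then d.*2 <= r else false.

Definition dist_sum_lt (T : finType) (G : sgraph T) (r : nat) (v x y : T) :
  bool :=
  if (dist G v x, dist G v y) is (Some d, Some d') then d + d' < r else false.

Lemma adj_verts (T : finType) (G : sgraph T) (x y : T) :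
  adj G x y -> (x \in verts G) && (y \in verts G).
Proof.
move=> xy; have /forall_inP/(_ _ xy)/andP[_] := edges_wf G.
by rewrite subUset !sub1set.
Qed.

Lemma dist_spec (T : finType) (G : sgraph T) (x y : T) (d : nat) :
  dist G x y = Some d -> walk G x y d /\ forall n, walk G x y n -> d <= n.
Proof. by rewrite /dist; case: {-}_ / idP => // xy [<-]; case: ex_minnP. Qed.

Lemma dist_adj (T : finType) (G : sgraph T) (v x y : T) (d d' : nat) :
  adj G x y -> dist G v x = Some d -> dist G v y = Some d' -> d' <= d.+1.
Proof.
move=> xy /dist_spec[/existsP[p /andP[vp /eqP px]] _] /dist_spec[_]; apply.
apply/existsP; exists [tuple of rcons p y].
by rewrite rcons_path vp px xy last_rcons eqxx.
Qed.

Definition ball_verts (T : finType) (G : sgraph T) (r : nat) (v : T) :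
  {set T} := [set x in verts G | dist_le_half G r v x].

Definition ball_edges (T : finType) (G : sgraph T) (r : nat) (v : T) :
  {set {set T}} :=
  [set e in edges G | [exists x, exists y,
    (e == [set x; y]) && dist_sum_lt G r v x y]].

Lemma ball_wf (T : finType) (G : sgraph T) (r : nat) (v : T) :
  [forall e in ball_edges G r v, (#|e| == 2) && (e \subset ball_verts G r v)].
Proof.
apply/forall_inP => e; rewrite inE.
case/andP => eG /existsP[x /existsP[y /andP[/eqP eE]]].
have /forall_inP/(_ e eG)/andP[-> _] := edges_wf G.
have xy : adj G x y by rewrite /adj -eE.
have yx : adj G y x by rewrite /adj setUC -eE.
have /andP[xV yV] := adj_verts xy.
rewrite /dist_sum_lt eE subUset !sub1set !inE xV yV /dist_le_half.
case dx: (dist G v x) => [d|//]; case dy: (dist G v y) => [d'|//] lt_r.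
have le1 := dist_adj xy dx dy; have le2 := dist_adj yx dy dx.
rewrite -!addnn /=; apply/andP; split.
  by apply: leq_trans lt_r; rewrite -addnS leq_add2l.
by apply: leq_trans lt_r; rewrite -addSn leq_add2r.
Qed.

(* The ball of radius r/2 around [v]; the radius may be a half-integer. *)
Definition ball (T : finType) (G : sgraph T) (r : nat) (v : T) : sgraph T :=
  SGraph (ball_wf G r v).

Definition locally_chordal (T : finType) (r : nat) (G : sgraph T) : Prop :=
  {in verts G, forall v, chordal (ball G r v)}.

Definition is_clique (T : finType) (G : sgraph T) (K : {set T}) : bool :=
  (K \subset verts G) &&
  [forall x in K, forall y in K, (x != y) ==> adj G x y].

Definition max_cliques (T : finType) (G : sgraph T) : {set {set T}} :=
  [set K | maxset (is_clique G) K].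

Definition max_cliques_at (T : finType) (G : sgraph T) (v : T) :
  {set {set T}} := [set K in max_cliques G | v \in K].

Definition clique_intersection_graph (T : finType) (G : sgraph T) :
  sgraph {set T} :=
  graph_of (max_cliques G) (fun K1 K2 => K1 :&: K2 != set0).

(* For an edge e = {K1, K2} this is #|K1 :&: K2|. *)
Definition edge_weight (T : finType) (e : {set {set T}}) : nat :=
  #|\bigcap_(K in e) K|.

Definition total_weight (T : finType) (H : sgraph {set T}) : nat :=
  \sum_(e in edges H) edge_weight e.

Definition at_vertex (T : finType) (G : sgraph T) (H : sgraph {set T}) (v : T) :
  sgraph {set T} := induced H (max_cliques_at G v).

Definition k_acyclic_spanning (T : finType) (G : sgraph T) (k : nat)
    (H : sgraph {set T}) : Prop :=
  spanning_subgraph H (clique_intersection_graph G) /\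
  forall X : {set T}, X \subset verts G -> #|X| <= k ->
    acyclic (bigunion X (at_vertex G H)).

Definition max_weight_k_acyclic_spanning (T : finType) (G : sgraph T) (k : nat)
    (H : sgraph {set T}) : Prop :=
  k_acyclic_spanning G k H /\
  forall H' : sgraph {set T}, k_acyclic_spanning G k H' ->
    total_weight H' <= total_weight H.

Definition clique_graph (T : finType) (G : sgraph T) (H : sgraph {set T}) :
  Prop :=
  spanning_subgraph H (clique_intersection_graph G) /\
  {in verts G, forall v, graph_connected (at_vertex G H v)}.

(* Taken in [int] so that the subtraction is not truncated. *)
Definition clique_excess (T : finType) (G : sgraph T) : int :=
  ((\sum_(K in max_cliques G) #|K|)%:Z - #|verts G|%:Z)%R.

(* Main.v *)
Require Import Defs.
From mathcomp Require Import all_boot all_algebra zify.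

(** Write [K v] for the set of maximal cliques containing [v], and [H_v] for
the subgraph that [H] induces on [K v].  Counting each edge of [H] once for
every vertex in the intersection of its two cliques shows that the weight of
[H] is the sum over [v] of the number of edges of [H_v].  If every [H_v] is a
forest, this is at most the sum of the [#|K v|.-1], which is the excess of [G],
with equality iff every [H_v] is a tree ([acyclic_weight]).  So the third
condition describes the 2-acyclic clique graphs, and two facts remain.

Some 2-acyclic clique graph exists, so that the bound is attained
([exists_2acyclic_clique_graph]).  The closed neighbourhood of [v] is chordal,
hence has a clique tree, which is a spanning tree on [K v] whose restriction to
each [K u] is connected; by the weight count these are the spanning trees of
maximum weight.  Breaking ties between spanning trees by one global injective
and additive code of edge sets selects a tree [M v] on each [K v].  Two selected
trees agree on [K u :&: K v]: otherwise exchanging one restriction for the other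
would improve one of them.  Hence the union of the [M v] restricts to [M v] on
each [K v] ([glue_trees]).

Conversely, a 2-acyclic clique graph is [r]-acyclic
([clique_graph_r_acyclic]).  Let [X] have at most [r] vertices.  A cycle of [G]
inside [X] lies in the ball around any of its vertices, so the graph induced on
[X] is chordal and by Dirac's theorem ([chordal_simplicial]) it can be taken
apart by deleting simplicial vertices.  Adding back a simplicial vertex [x] glues
the tree [H_x] to the union of the earlier [H_y] along the union of the trees on
[K x :&: K y], for [y] a neighbour of [x]; these share a maximal clique that
contains [x] and all its neighbours, so their union is connected, and gluing two
forests along a connected graph creates no cycle ([indep_bigcup]).

Forests are handled by linear algebra over the field with two elements.  An edge
is the sum of its ends; a set of edges is acyclic iff it is linearly independent,
and it connects a set [S] of vertices iff it spans the space [evens S] of chains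
on [S] with coordinate sum zero, which has dimension [#|S|.-1].  Counting edges
of a forest, gluing forests and intersecting trees then become dimension
formulas. *)

Set Implicit Arguments.
Unset Strict Implicit.
Unset Printing Implicit Defensive.

Import GRing.Theory.

(** * Edge sets as vectors over the field with two elements *)

Notation chain U := {ffun U -> ('F_2)^o}.

Section EdgeSpaces.

Variable U : finType.
Implicit Types (a b x y : U) (e S P Q : {set U}) (E F D A B : {set {set U}}).
Implicit Types c : chain U.

Definition chi e : chain U := [ffun x => (x \in e)%:R%R].

Definition espan E : {vspace chain U} := (\sum_(e in E) <[chi e]>)%VS.

Definition indep E := \dim (espan E) == #|E|.

Definition pairs S : {set {set U}} :=
  [set e : {set U} | (#|e| == 2) && (e \subset S)].

(** The chains on [S] with coordinate sum zero, by [evensP]; edges between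
vertices of [S] connect all of [S] iff their span contains them. *)
Definition evens S : {vspace chain U} := espan (pairs S).

Definition inside E S := [set e in E | e \subset S].

Definition bd x y : chain U := (chi [set x] + chi [set y])%R.

Lemma F2_case (k : 'F_2) : k = 0%R \/ k = 1%R.
Proof. by case: k => [[|[|//]] i]; [left | right]; apply: val_inj. Qed.

Lemma addcc c : (c + c = 0)%R.
Proof.
apply/ffunP=> i; rewrite !ffunE.
by case: (F2_case (c i)) => ->; apply: val_inj.
Qed.

Lemma chi_in_espan e E : e \in E -> chi e \in espan E.
Proof. by move=> eE; rewrite memvE; apply: (sumv_sup e). Qed.

Lemma espan_subv E (W : {vspace chain U}) :
  (forall e, e \in E -> chi e \in W) -> (espan E <= W)%VS.
Proof. by move=> h; apply/subv_sumP => e /h; rewrite memvE. Qed.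

Lemma espanS E F : E \subset F -> (espan E <= espan F)%VS.
Proof.
by move=> /subsetP EF; apply: espan_subv => e /EF; apply: chi_in_espan.
Qed.

Lemma espan0 : espan set0 = 0%VS.
Proof. by rewrite /espan big_set0. Qed.

Lemma espan1 e : espan [set e] = <[chi e]>%VS.
Proof. by rewrite /espan big_set1. Qed.

Lemma espanU E F : espan (E :|: F) = (espan E + espan F)%VS.
Proof.
apply/eqP; rewrite eqEsubv; apply/andP; split; last first.
  by rewrite subv_add !espanS ?subsetUl ?subsetUr.
apply: espan_subv => e.
rewrite inE => /orP[] /chi_in_espan h; move: h; apply: subvP.
  exact: addvSl.
exact: addvSr.
Qed.

Lemma dim_espan E : \dim (espan E) <= #|E|.
Proof.
rewrite -sum1_card /espan; apply: (leq_trans (dimv_leq_sum _ _ _)).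
by apply: leq_sum => e _; rewrite dim_vline leq_b1.
Qed.

Lemma setU_D E F : E \subset F -> F = E :|: F :\: E.
Proof. by move=> /setIidPr EF; rewrite -{1}(setID F E) EF. Qed.

Lemma indepS E F : E \subset F -> indep F -> indep E.
Proof.
move=> EF /eqP iF; rewrite /indep eqn_leq dim_espan /=.
have: #|F| <= \dim (espan E) + #|F :\: E|.
  rewrite -iF {1}(setU_D EF) espanU.
  apply: (leq_trans (dimv_add_leqif _ _)).
  by rewrite leq_add2l dim_espan.
by rewrite -(cardsID E F) (setIidPr EF) leq_add2r.
Qed.

Lemma indep0 : indep set0.
Proof. by rewrite /indep espan0 dimv0 cards0. Qed.

Lemma indepU1 e E : indep E -> chi e \notin espan E -> indep (e |: E).
Proof.
move=> /eqP iE eE; have neE: e \notin E by apply: contra eE => /chi_in_espan.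
have e0: chi e != 0%R by apply: contra eE => /eqP ->; rewrite mem0v.
rewrite /indep cardsU1 neE espanU espan1 dimv_disjoint_sum ?dim_vline ?e0 ?iE //.
apply/eqP; rewrite -subv0; apply/subvP => c.
rewrite memv_cap memv0 => /andP[/vlineP[k ->]].
by case: (F2_case k) => ->; rewrite ?scale0r ?scale1r ?eqxx // (negPf eE).
Qed.

Lemma indepU1N e E : indep (e |: E) -> e \notin E -> chi e \notin espan E.
Proof.
move=> /eqP iE eE; apply/negP=> h; move: iE; rewrite cardsU1 eE espanU espan1.
have /addv_idPr ->: (<[chi e]> <= espan E)%VS by rewrite -memvE.
by move=> iE; have := dim_espan E; rewrite iE add1n ltnn.
Qed.

(** The only nonzero coefficient is 1, so a linear relation is the vanishing of a
plain sum over some of the edges. *)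
Lemma dependent_zero_sum E : ~~ indep E ->
  exists D, [/\ D \subset E, D != set0 & (\sum_(e in D) chi e = 0)%R].
Proof.
move=> nE.
have [D /minsetP[nD minD] DE] := @minset_exists _ (fun F => ~~ indep F) E nE.
have D0: D != set0 by apply: contraNneq nD => ->; exact: indep0.
have [e eD] := set0Pn _ D0.
have iDe: indep (D :\ e).
  apply: contraT => /minD /(_ (subsetDl _ _)) /setP /(_ e).
  by rewrite !inE eqxx eD.
have: chi e \in espan (D :\ e).
  by apply: contraR nD => /(indepU1 iDe); rewrite setD1K.
case/memv_sumP => v vD ve.
have v01 f : f \in D :\ e -> v f = 0%R \/ v f = chi f.
  move=> /vD /vlineP[k ->]; case: (F2_case k) => ->.
    by left; rewrite scale0r.
  by right; rewrite scale1r.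
exists (e |: [set f in D :\ e | v f != 0%R]); split.
- apply: subset_trans DE; rewrite subUset sub1set eD.
  by apply/subsetP=> f; rewrite !inE -andbA => /and3P[].
- by apply/set0Pn; exists e; rewrite !inE eqxx.
rewrite big_setU1 ?inE ?eqxx //= {1}ve.
rewrite [X in (_ + X)%R](_ : _ = (\sum_(f in D :\ e) v f)%R) ?addcc //.
rewrite [RHS](bigID (fun f => v f != 0%R)) /= [X in (_ + X)%R]big1 ?addr0;
  last first.
  by move=> f /andP[_]; rewrite negbK => /eqP.
apply: eq_big => [f|f]; first by rewrite !inE.
rewrite !inE => /andP[fD f0].
by case: (v01 f) f0 => [|->|->]; rewrite ?inE ?eqxx.
Qed.

Lemma espan_ind (K : chain U -> Prop) E :
    K 0%R -> (forall c d, K c -> K d -> K (c + d)%R) ->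
    (forall e, e \in E -> K (chi e)) -> forall c, c \in espan E -> K c.
Proof.
move=> K0 KD KE c /memv_sumP[v vE ->]; apply: big_ind => // e /[dup] eE /vE.
case/vlineP=> k ->; case: (F2_case k) => ->; first by rewrite scale0r.
by rewrite scale1r; apply: KE.
Qed.

Lemma bdxx x : bd x x = 0%R. Proof. exact: addcc. Qed.

Lemma bdC x y : bd x y = bd y x. Proof. exact: addrC. Qed.

Lemma bd_trans x y z : (bd x y + bd y z = bd x z)%R.
Proof. by rewrite /bd addrA -[(_ + _ + chi [set y])%R]addrA addcc addr0. Qed.

Lemma chi_pair x y : x != y -> chi [set x; y] = bd x y.
Proof.
move=> xy; apply/ffunP=> z; rewrite !ffunE !inE.
by have [-> | zx] := eqVneq z x; rewrite ?(negPf xy) ?addr0 ?add0r.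
Qed.

Lemma bd_in_espan x y E : [set x; y] \in E -> bd x y \in espan E.
Proof.
have [-> _ | xy] := eqVneq x y; first by rewrite bdxx mem0v.
by rewrite -(chi_pair xy) => /chi_in_espan.
Qed.

Lemma in_pairs S x y : ([set x; y] \in pairs S) = [&& x != y, x \in S & y \in S].
Proof. by rewrite inE cards2 subUset !sub1set; case: (x == y). Qed.

Lemma pairsP S e : reflect
  (exists x y, [/\ x != y, x \in S, y \in S & e = [set x; y]]) (e \in pairs S).
Proof.
apply: (iffP idP) => [|[x [y [xy xS yS ->]]]]; last by rewrite in_pairs xy xS.
rewrite inE => /andP[/cards2P[x [y [xy ->]]]]; rewrite subUset !sub1set.
by case/andP=> xS yS; exists x, y.
Qed.

Lemma pairsS P Q : P \subset Q -> pairs P \subset pairs Q.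
Proof.
move=> PQ; apply/subsetP=> e; rewrite !inE => /andP[-> /subset_trans]; exact.
Qed.

Lemma bd_in_evens x y S : x \in S -> y \in S -> bd x y \in evens S.
Proof.
move=> xS yS; have [-> | xy] := eqVneq x y; first by rewrite bdxx mem0v.
by apply: bd_in_espan; rewrite in_pairs xy xS.
Qed.

Lemma evens_subv S (W : {vspace chain U}) :
  (forall x y, x \in S -> y \in S -> bd x y \in W) -> (evens S <= W)%VS.
Proof.
move=> h; apply: espan_subv => e /pairsP[x [y [xy xS yS ->]]].
by rewrite chi_pair ?h.
Qed.

Lemma espan_evens E S : E \subset pairs S -> (espan E <= evens S)%VS.
Proof. exact: espanS. Qed.

Lemma evensP c S :
  reflect ((forall x, x \notin S -> c x = 0%R) /\ (\sum_x c x = 0)%R)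
    (c \in evens S).
Proof.
apply: (iffP idP) => [|[cS c0]].
  pose K (c : chain U) :=
    (forall x, x \notin S -> c x = 0%R) /\ (\sum_x c x = 0)%R.
  apply: (@espan_ind K) => [|c1 c2 [h1 s1] [h2 s2] |].
  - by split=> [x _|]; rewrite ?big1 // => *; rewrite ffunE.
  - split=> [x xS|]; first by rewrite ffunE h1 ?h2 ?addr0.
    rewrite (eq_bigr (fun x => c1 x + c2 x)%R) => [|x _]; last by rewrite ffunE.
    by rewrite big_split /= s1 s2 addr0.
  move=> e; rewrite inE => /andP[/eqP e2 /subsetP eS]; split=> [x|].
    by rewrite ffunE; case: (boolP (x \in e)) => // /eS ->.
  rewrite (eq_bigr (fun x => (x \in e)%:R)%R) => [|x _]; last by rewrite ffunE.
  by rewrite -natr_sum -big_mkcond sum1_card e2; apply: val_inj.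
have [S0 | [s sS]] := set_0Vmem S.
  suff ->: c = 0%R by rewrite mem0v.
  by apply/ffunP=> x; rewrite ffunE cS // S0 inE.
(* As the coordinates of [c] sum to zero, adding [s] to every term changes
   nothing. *)
suff ->: c = (\sum_(x in S) c x *: bd s x)%R.
  by apply: memv_suml => x xS; rewrite memvZ // bd_in_evens.
have cS0: (\sum_(x in S) c x = 0)%R.
  by rewrite -[RHS]c0 [RHS](bigID (mem S)) /= [X in (_ + X)%R]big1 ?addr0.
apply/ffunP=> z; rewrite sum_ffunE.
transitivity (\sum_(x in S) (c x * (z == s)%:R + c x * (x == z)%:R))%R;
  last first.
  by apply: eq_bigr => x _; rewrite !ffunE !inE (eq_sym z x) -mulrDr.
rewrite big_split /= -big_distrl /= cS0 mul0r add0r.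
have [zS | zS] := boolP (z \in S).
  rewrite (bigD1 z) //= eqxx mulr1 big1 ?addr0 // => x /andP[_ /negPf ->].
  by rewrite mulr0.
rewrite cS // big1 // => x xS; case: eqVneq => [xz | _]; last by rewrite mulr0.
by rewrite -xz xS in zS.
Qed.

Lemma evensS P Q : P \subset Q -> (evens P <= evens Q)%VS.
Proof. by move=> PQ; apply/espanS/pairsS. Qed.

Lemma evens_capv P Q : (evens P :&: evens Q <= evens (P :&: Q))%VS.
Proof.
apply/subvP => c; rewrite memv_cap => /andP[/evensP[cP c0] /evensP[cQ _]].
by apply/evensP; split=> // x; rewrite inE negb_and => /orP[/cP|/cQ].
Qed.

(** The star at any vertex of a nonempty [S] is a basis. *)
Lemma dim_evens S : \dim (evens S) = #|S|.-1.
Proof.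
have [-> | [s sS]] := set_0Vmem S.
  rewrite cards0 /evens (_ : pairs set0 = set0) ?espan0 ?dimv0 //.
  by apply/setP=> e; rewrite !inE subset0 -cards_eq0; case: eqP => // ->.
pose star := [set [set s; x] | x in S :\ s].
have inj: {in S :\ s &, injective (fun x => [set s; x])}.
  move=> x y; rewrite !inE => /andP[xs _] _ /setP/(_ x).
  by rewrite !inE eqxx orbT (negPf xs) => /esym/eqP.
have -> : evens S = espan star.
  apply/eqP; rewrite eqEsubv; apply/andP; split.
    have sx x : x \in S -> bd s x \in espan star.
      move=> xS; have [-> | xs] := eqVneq x s; first by rewrite bdxx mem0v.
      by apply: bd_in_espan; apply/imsetP; exists x; rewrite ?inE ?xs.
    apply: evens_subv => x y xS yS.
    by rewrite -(bd_trans x s y) memvD // ?(bdC x) sx.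
  apply: espan_evens; apply/subsetP=> e /imsetP[x].
  rewrite inE in_set1 => /andP[xs xS] ->.
  by rewrite in_pairs eq_sym xs sS.
suff /eqP ->: indep star.
  by rewrite card_in_imset // (cardsD1 s S) sS.
apply: contraT => /dependent_zero_sum[D [Dstar /set0Pn[e eD] /ffunP]].
(* A leaf of the star lies on a single edge. *)
have /imsetP[x xS def_e] := subsetP Dstar e eD.
move=> /(_ x); rewrite sum_ffunE ffunE (bigD1 e) //= ffunE def_e !inE eqxx orbT.
rewrite big1 ?addr0 // => f /andP[fD fe]; rewrite ffunE.
have /imsetP[y yS def_f] := subsetP Dstar f fD.
case: (boolP (x \in f)) => //; rewrite def_f !inE => /orP[/eqP xs | /eqP xy].
  by move: xS; rewrite xs !inE eqxx.
by rewrite def_f xy eqxx in fe.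
Qed.

(** Two forests glued along a connected graph form a forest: a chain in both
spans is supported on [P :&: Q] with sum zero, so it comes from the common edges,
and the dimension formula for a sum of subspaces gives independence. *)
Lemma indepU A B P Q : A \subset pairs P -> B \subset pairs Q ->
  indep A -> indep B -> (evens (P :&: Q) <= espan (A :&: B))%VS ->
  indep (A :|: B).
Proof.
move=> AP BQ /eqP iA /eqP iB hC; rewrite /indep eqn_leq dim_espan /=.
rewrite espanU -(leq_add2r #|A :&: B|) cardsUI -iA -iB -dimv_sum_cap leq_add2l.
apply: leq_trans (dim_espan _); apply: dimvS; apply: subv_trans hC.
apply: subv_trans (evens_capv _ _); rewrite subv_cap.
apply/andP; split; first exact: subv_trans (capvSl _ _) (espan_evens AP).
exact: subv_trans (capvSr _ _) (espan_evens BQ).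
Qed.

(** Two trees whose union is a forest meet in a tree: when the union is
independent, the spans meet exactly in the span of the common edges. *)
Lemma evens_espan_capv A B P Q : indep (A :|: B) ->
  (evens P <= espan A)%VS -> (evens Q <= espan B)%VS ->
  (evens (P :&: Q) <= espan (A :&: B))%VS.
Proof.
move=> iAB PA QB.
have iA := indepS (subsetUl A B) iAB; have iB := indepS (subsetUr A B) iAB.
have iC := indepS (subset_trans (subsetIl A B) (subsetUl A B)) iAB.
have sub: (espan (A :&: B) <= espan A :&: espan B)%VS.
  by rewrite subv_cap !espanS ?subsetIl ?subsetIr.
have /eqP -> : espan (A :&: B) == (espan A :&: espan B)%VS.
  rewrite -(dimv_leqif_eq sub) (eqP iC) -(eqn_add2l #|A :|: B|) cardsUI.
  by rewrite -{1}(eqP iAB) espanU dimv_sum_cap (eqP iA) (eqP iB).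
rewrite subv_cap (subv_trans _ PA) ?(subv_trans _ QB) // evensS //.
  exact: subsetIr.
exact: subsetIl.
Qed.

(** Connected graphs sharing the vertex [q] have a connected union. *)
Lemma evens_bigcup (I : finType) (X : {set I}) (S_ : I -> {set U}) q
    (W : {vspace chain U}) :
  (forall i, i \in X -> (q \in S_ i) || (S_ i == set0)) ->
  (forall i, i \in X -> (evens (S_ i) <= W)%VS) ->
  (evens (\bigcup_(i in X) S_ i) <= W)%VS.
Proof.
move=> qS SW; apply: evens_subv => x y.
have hq z : z \in \bigcup_(i in X) S_ i -> bd z q \in W.
  case/bigcupP=> i iX zS; apply: (subvP (SW i iX)); apply: bd_in_evens => //.
  by case/orP: (qS i iX) => // /eqP S0; rewrite S0 inE in zS.
by move=> xS yS; rewrite -(bd_trans x q y) memvD // ?(bdC q) hq.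
Qed.

(** * Acyclic and connected graphs in linear terms *)

Lemma path_bd E x p :
  path (fun a b => [set a; b] \in E) x p -> bd x (last x p) \in espan E.
Proof.
elim: p x => [|y p IH] x /=; first by rewrite bdxx mem0v.
by case/andP=> xy /IH yp; rewrite -(bd_trans x y) memvD // bd_in_espan.
Qed.

Lemma card_edge (G : sgraph U) e : e \in edges G -> #|e| = 2.
Proof. by move=> eG; have /forall_inP/(_ e eG)/andP[/eqP] := edges_wf G. Qed.

(** The first edge of a cycle is the sum of the others. *)
Lemma indep_acyclic (G : sgraph U) : indep (edges G) -> acyclic G.
Proof.
move=> iG [|x [|y [|z p]]]; rewrite /is_cycle //=.
apply/negP=> /and4P[/and3P[xNyzp yNzp zNp] xy yz].
rewrite rcons_path => /andP[zp px].
pose e := [set x; y]; have eE: e \in edges G := xy.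
have := @indepU1N e (edges G :\ e); rewrite setD1K // !inE eqxx /= => /(_ iG isT).
have x_y: x != y by apply: contra xNyzp => /eqP <-; rewrite mem_head.
have last_in : last z p \in z :: p by exact: mem_last.
rewrite chi_pair // -(bd_trans x (last z p)) memvD //.
  rewrite bdC; apply: bd_in_espan; rewrite !inE [_ \in edges G]px andbT.
  apply: contraNneq yNzp => /setP/(_ y).
  by rewrite !inE eqxx orbT (eq_sym y x) (negPf x_y) orbF => /eqP ->.
rewrite bdC; apply: (@path_bd _ y (z :: p)).
apply: (@sub_in_path _ (predC1 x) (adj G)).
- move=> a b; rewrite !inE => ax bx ab; rewrite ?inE [_ \in edges G]ab andbT.
  apply/eqP=> /setP/(_ x).
  by rewrite !inE eqxx /= !(eq_sym x) (negPf ax) (negPf bx).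
- by apply/allP=> a ap /=; apply: contraNneq xNyzp => <-.
by rewrite /= yz.
Qed.

(** The first vertex of a longest path has a second neighbour, and by maximality
that neighbour lies on the path. *)
Lemma min_degree2_cycle (G : sgraph U) (D : {set {set U}}) :
  D \subset edges G -> D != set0 ->
  (forall a b, [set a; b] \in D -> exists2 b', b' != b & [set a; b'] \in D) ->
  exists p, is_cycle G p.
Proof.
move=> DG /set0Pn[e eD] deg2; pose r : rel U := fun a b => [set a; b] \in D.
have rN a b : r a b -> a != b.
  by move=> /(subsetP DG)/card_edge; rewrite cards2; case: (a == b).
have [a [b [_ def_e]]] : exists a b, a != b /\ e = [set a; b].
  by have /eqP/cards2P[a [b [ab ->]]] := card_edge (subsetP DG e eD); exists a, b.
have rab: r a b by rewrite /r -def_e.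
pose long n := [exists p : n.-tuple U, exists x, path r x p && uniq (x :: p)].
have long1: long 1.
  apply/existsP; exists [tuple b]; apply/existsP; exists a.
  by rewrite /= rab /= inE rN.
have bound n : long n -> n <= #|U|.
  case/existsP=> p /existsP[x /andP[_ xp]].
  have := max_card (mem (x :: p)).
  by rewrite (card_uniqP xp) /= size_tuple => /ltnW.
have exlong : exists n, long n by exists 1.
case: (ex_maxnP exlong bound) => n.
case/existsP=> p /existsP[x /andP[xp up]] nmax.
have n1 := nmax _ long1.
have := size_tuple p; case: {p}(p : seq U) xp up => [|y p] /= xp up size_p.
  by rewrite -size_p in n1.
have [xy yp] := andP xp; have [z zy xz] := deg2 _ _ xy.
have zp: z \in p.
  have: z \in [:: x, y & p].
    apply: contraT => zxp.
    suff /nmax: long n.+1 by rewrite ltnn.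
    have sz: size [:: x, y & p] == n.+1 by rewrite /= size_p.
    apply/existsP; exists (Tuple sz); apply/existsP; exists z.
    by rewrite /= in zxp *; rewrite zxp up xy yp /r setUC [_ \in D]xz.
  by rewrite !inE (negPf zy) eq_sym (negPf (rN _ _ xz)).
have {}xp: path r x (y :: p) by [].
have {}up: uniq [:: x, y & p] by [].
case/path.splitP: zp xp up => p1 p2.
rewrite -!cat_cons cat_path cat_uniq => /andP[xp _] /andP[up _].
have DE: subrel r (adj G) by move=> u v; apply: (subsetP DG).
exists (x :: y :: rcons p1 z).
rewrite /is_cycle /= size_rcons /=; move: (up) => /= ->.
have := sub_path DE xp; rewrite [path _ _ _]/= => /andP[-> pz].
by rewrite rcons_path pz last_rcons [adj G z x]DE // /r setUC.
Qed.

(** In a sum of edges that vanishes every vertex is covered an even number of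
times, so no vertex has degree 1. *)
Lemma acyclic_indep (G : sgraph U) : acyclic G -> indep (edges G).
Proof.
move=> acG; apply: contraT => /dependent_zero_sum[D [DG D0 sum0]].
suff [p] : exists p, is_cycle G p by rewrite (negPf (acG p)).
apply: (min_degree2_cycle DG D0) => a b abD.
have [/existsP[f /and3P[fD fab af]] |] :=
    boolP [exists f, [&& f \in D, f != [set a; b] & a \in f]].
  have /eqP/cards2P[x [y [xy def_f]]] := card_edge (subsetP DG f fD).
  move: af fD fab; rewrite def_f !inE => /orP[] /eqP -> fD fab.
    by exists y => //; apply: contraNneq fab => ->.
  by exists x; rewrite 1?setUC //; apply: contraNneq fab => ->; rewrite setUC.
rewrite negb_exists => /forallP no; move/ffunP/(_ a): sum0.
rewrite sum_ffunE ffunE (bigD1 _ abD) //= ffunE !inE eqxx /=.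
rewrite big1 ?addr0 // => f /andP[fD fab].
by have := no f; rewrite unfold_in [_ f]fD fab ffunE /= => /negPf ->.
Qed.

Lemma connect_evens (G : sgraph U) S :
  {in S &, forall x y, connect (adj G) x y} -> (evens S <= espan (edges G))%VS.
Proof.
move=> con; apply: evens_subv => x y xS yS.
by have /connectP[p xp ->] := con x y xS yS; apply: path_bd.
Qed.

(** Summing the coordinates over the component of [x] is a functional that kills
every edge; as it kills [bd x y] too, [y] is in that component. *)
Lemma evens_connect (G : sgraph U) S :
  (evens S <= espan (edges G))%VS -> {in S &, forall x y, connect (adj G) x y}.
Proof.
move=> SG x y xS yS; apply: contraT => nxy.
pose K (c : chain U) := (\sum_(z | connect (adj G) x z) c z = 0)%R.
have symG : symmetric (adj G) by move=> a b; rewrite /adj setUC.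
have Kxy: K (bd x y).
  apply: (@espan_ind K (edges G)); last exact: (subvP SG) (bd_in_evens xS yS).
  - by apply: big1 => z _; rewrite ffunE.
  - move=> c d Kc Kd; rewrite /K; under eq_bigr do rewrite ffunE.
    by rewrite big_split /= Kc Kd addr0.
  move=> e eG; have /eqP/cards2P[a [b [ab def_e]]] := card_edge eG.
  have abG: adj G a b by rewrite /adj -def_e.
  have con_ab: connect (adj G) x a = connect (adj G) x b.
    exact: (same_connect_r (sym_connect_sym symG) (connect1 abG)).
  rewrite /K def_e.
  have [xa | xa] := boolP (connect (adj G) x a).
    rewrite (bigD1 a) //= (bigD1 b) /=; last by rewrite -con_ab xa eq_sym.
    rewrite !ffunE !inE !eqxx orbT big1 ?addr0; first exact: val_inj.
    by move=> z /andP[/andP[_ za] zb]; rewrite ffunE !inE (negPf za) (negPf zb).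
  apply: big1 => z xz; rewrite ffunE !inE.
  have za: z != a by apply: contraNneq xa => <-.
  have zb: z != b by rewrite con_ab in xa; apply: contraNneq xa => <-.
  by rewrite (negPf za) (negPf zb).
have xy: x != y by apply: contraNneq nxy => ->; exact: connect0.
move: Kxy; rewrite /K (bigD1 x) ?connect0 //= big1 ?addr0; last first.
  move=> z /andP[xz zx]; rewrite !ffunE !inE (negPf zx) add0r.
  by case: eqVneq xz nxy => // -> ->.
by rewrite !ffunE !inE eqxx (negPf xy).
Qed.

End EdgeSpaces.

(** * Simplicial vertices of chordal graphs *)

Lemma shortcut_shorter i j n : i.+1 < j -> j < n.+1 -> i + (n - j.-1) < n.
Proof. by lia. Qed.

Section Simplicial.

Variables (T : finType) (R : rel T).
Hypotheses (symR : symmetric R) (irrR : irreflexive R).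
Implicit Types (X Y C S : {set T}) (v x y : T).

Definition chordal_on X := forall c : seq T,
  uniq c -> cycle R c -> {subset c <= X} -> 4 <= size c ->
  exists x y, [/\ x \in c, y \in c, R x y, y != next c x & x != next c y].

Definition clique_on X := {in X &, forall x y, x != y -> R x y}.

Definition nbhd X x : {set T} := [set y in X | R x y].

Definition simplicial X x := x \in X /\ clique_on (nbhd X x).

Lemma chordal_onS X Y : X \subset Y -> chordal_on Y -> chordal_on X.
Proof.
move=> /subsetP XY chY c uc cc cX; apply: chY => // x /cX; exact: XY.
Qed.

(** If [s] and [t] are neighbours of [v] joined by a path through vertices that
are not adjacent to [v], then they are adjacent.  Otherwise a shortest such path
closes up through [v] to a cycle of length at least 4, in which a chord at [v] is
excluded and any other chord shortens the path. *)
Lemma chordless_detour X C v s t q :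
  chordal_on X -> v \in X -> s \in X -> t \in X -> C \subset X ->
  (forall c, c \in C -> c != v /\ ~~ R v c) -> R v s -> R v t -> s != t ->
  uniq (s :: q) -> path R s q -> last s q = t ->
  {in q, forall z, z \in C \/ z = t} -> R s t.
Proof.
move=> chX vX sX tX /subsetP CX Cv vs vt st.
have [n] := ubnP (size q); elim: n q => // n IH q lt_q uq Rq qt qC.
apply: contraT => nst.
have qX: {subset s :: q <= X}.
  by move=> z; rewrite inE => /orP[/eqP-> // | /qC[/CX | ->]].
have q_notv: v \notin s :: q.
  apply/negP; rewrite inE => /orP[/eqP vseq | /qC[/Cv[] | vteq]].
  - by rewrite vseq irrR in vs.
  - by rewrite eqxx.
  - by rewrite vteq irrR in vt.
have size_q: 2 <= size q.
  case: q {IH lt_q uq qC qX q_notv} Rq qt => [|a [|b q]] //= Rq qt.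
    by rewrite qt eqxx in st.
  by move: Rq; rewrite andbT qt (negPf nst).
have q_nv z : z \in s :: q -> R v z -> z = s \/ z = t.
  rewrite inE => /orP[/eqP->|/qC[/Cv[_ /negP h /h]|->]] //; by [left | right].
have nextE z : z \in s :: q ->
    next [:: v, s & q] z = nth v (s :: q) (index z (s :: q)).+1.
  move=> zq; rewrite next_nth inE zq orbT [index z (v :: _)]/=.
  by have /negPf -> : v != z by apply: contraNneq q_notv => ->.
have [//||||x [y [xc yc xy yx nyx]]] := chX [:: v, s & q].
- by rewrite cons_uniq q_notv.
- by rewrite /= rcons_path vs Rq qt symR vt.
- by move=> z; rewrite inE => /orP[/eqP-> | /qX].
- by rewrite /= !ltnS.
(* A chord from [a] to a later vertex [b] allows to skip what lies between. *)
have chord_short a b : a \in s :: q -> b \in s :: q -> R a b ->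
    b != next [:: v, s & q] a -> index a (s :: q) < index b (s :: q) -> False.
  move=> aq bq ab; rewrite (nextE a aq) => b_next.
  set i := index a _; set j := index b _ => ij.
  have i1j: i.+1 < j.
    rewrite ltn_neqAle ij andbT; apply: contraNneq b_next => ->.
    by rewrite nth_index.
  have jq: j < (size q).+1 by have := bq; rewrite -index_mem.
  have Dd: drop j.-1 q = b :: drop j q.
    have: nth v (s :: q) j = b by rewrite nth_index.
    by case: (j) i1j jq => [|k] //= _ kq <-; rewrite -drop_nth.
  have iq : i <= size q by apply: leq_trans (ltnW ij) _.
  have ij1 : i <= j.-1 by case: (j) ij.
  have lt_a: last s (take i q) = a.
    rewrite (last_nth v) size_takel // -[RHS](nth_index v aq) -/i.
    by case: (i) => //= k; rewrite nth_take.
  have := IH (take i q ++ drop j.-1 q); rewrite (negPf nst) => h.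
  apply: notF; apply: h.
  - rewrite size_cat size_drop size_takel //; apply: (@leq_trans (size q)) => //.
    exact: shortcut_shorter.
  - apply: subseq_uniq uq; rewrite /= eqxx -{3}(cat_take_drop i q).
    apply: cat_subseq => //; rewrite -(subnK ij1).
    by rewrite -drop_drop drop_subseq.
  - rewrite cat_path lt_a Dd /= ab.
    move: (Rq); rewrite -{1}(cat_take_drop i q) cat_path => /andP[-> _] /=.
    move: (Rq); rewrite -{1}(cat_take_drop j.-1 q) cat_path => /andP[_].
    by rewrite Dd => /andP[].
  - by rewrite last_cat Dd /= -qt -{2}(cat_take_drop j.-1 q) last_cat Dd.
  - by move=> z; rewrite mem_cat => /orP[/mem_take | /mem_drop]; apply: qC.
have v_nochord y' : y' \in s :: q -> R v y' -> y' != next [:: v, s & q] v ->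
    v != next [:: v, s & q] y' -> False.
  have -> : next [:: v, s & q] v = s by rewrite /= eqxx.
  move=> yq vy; rewrite nextE // => ys; case: (q_nv _ yq vy) => [yeq | ->].
    by rewrite yeq eqxx in ys.
  (* The successor of the last vertex [t] is [v], the default of [nth]. *)
  by rewrite -{1}qt index_last // nth_default ?eqxx.
move: xc yc; rewrite !inE -!(in_cons s) => /predU1P[xv | xq] /predU1P[yv | yq].
- by rewrite xv yv irrR in xy.
- by subst x; case: (v_nochord y).
- by subst y; rewrite symR in xy; case: (v_nochord x).
have [lt | lt | eqi] := ltngtP (index x (s :: q)) (index y (s :: q)).
- by case: (chord_short x y).
- by rewrite symR in xy; case: (chord_short y x).
- by move: xy; rewrite -(nth_index v xq) eqi nth_index // irrR.
Qed.

(** Induction needs this sharper form of Dirac's theorem.  Let [C] be the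
component of [w] among the non-neighbours of [v], and [S] the set of neighbours of [v] that
have a neighbour in [C].  By [chordless_detour], [S] is a clique.  Unless
[C :|: S] is a clique, the induction hypothesis applies to it at a vertex all of
whose non-neighbours lie in [C], and gives a vertex of [C]; that vertex is
simplicial in [X] because all its neighbours are in [C :|: S]. *)
Lemma nonneighbour_simplicial n X v w : #|X| <= n -> chordal_on X ->
  v \in X -> w \in X -> w != v -> ~~ R v w ->
  exists x, [/\ simplicial X x, x != v & ~~ R v x].
Proof.
elim: n X v w => [|n IH] X v w Xn chX vX wX wv nvw.
  by move: Xn; rewrite leqn0 cards_eq0 => /eqP X0; rewrite X0 inE in vX.
pose Y0 := [set y in X | (y != v) && ~~ R v y].
pose e := [rel a b | [&& R a b, a \in Y0 & b \in Y0]].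
have sym_e : symmetric e by move=> a b; rewrite /= symR [(a \in _) && _]andbC.
pose C := [set c | connect e w c].
have wY0: w \in Y0 by rewrite inE wX wv nvw.
have CY0 c : c \in C -> c \in Y0.
  rewrite inE => /connectP[p]; case/lastP: p => [_ -> //|p z].
  by rewrite rcons_path last_rcons => /andP[_ /and3P[_ _ zY]] ->.
have wC: w \in C by rewrite inE connect0.
have C_closed c d : c \in C -> d \in Y0 -> R c d -> d \in C.
  move=> cC dY cd; have := CY0 c cC; move: cC; rewrite !inE => wc cY.
  by apply: connect_trans wc (connect1 _); rewrite /= cd dY inE cY.
pose S := [set s in X | R v s && [exists c in C, R s c]].
have Cv c : c \in C -> c != v /\ ~~ R v c.
  by move/CY0; rewrite inE => /and3P[_ -> ->].
have CX : C \subset X by apply/subsetP=> c /CY0; rewrite inE => /andP[].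
have con_C a b : a \in C -> b \in C -> connect e a b.
  rewrite !inE => wa; apply: connect_trans.
  by rewrite (sym_connect_sym sym_e).
have S_clique : clique_on S.
  move=> s t; rewrite !inE => /and3P[sX vs /exists_inP[c cC sc]].
  case/and3P=> tX vt /exists_inP[d dC td] st.
  have /connectP[p0 ep0 dlast] := con_C c d cC dC.
  case/shortenP: ep0 dlast => p ep up _ dlast.
  have pC: {subset c :: p <= C}.
    move=> z /(path_connect ep) cz; move: cC; rewrite !inE => wc.
    exact: connect_trans wc cz.
  have sC: s \notin c :: p by apply/negP=> /pC/Cv[_]; rewrite vs.
  have tC: t \notin c :: p by apply/negP=> /pC/Cv[_]; rewrite vt.
  apply: (@chordless_detour X C v s t (rcons (c :: p) t)) => //.
  - by rewrite cons_uniq mem_rcons in_cons negb_or st sC rcons_uniq tC up.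
  - rewrite rcons_path /= sc -dlast symR td andbT.
    by apply: sub_path ep => a b /andP[].
  - by rewrite last_rcons.
  - by move=> z; rewrite mem_rcons inE => /predU1P[->|/pC]; [right | left].
pose Y := C :|: S.
have YX : Y \subset X.
  by rewrite subUset CX; apply/subsetP=> s; rewrite inE => /andP[].
have vY : v \notin Y.
  rewrite !inE vX irrR /= orbF; apply/negP=> vC.
  by have [] := Cv v; rewrite ?inE // eqxx.
have Yn : #|Y| <= n.
  rewrite -ltnS; apply: leq_trans Xn; apply: proper_card.
  by rewrite properE YX; apply/subsetPn; exists v.
have nbhd_Y x : x \in C -> nbhd X x \subset Y.
  move=> xC; apply/subsetP=> y; rewrite !inE => /andP[yX xy].
  have [xv nvx] := Cv x xC.
  have yv : y != v by apply: contraNneq nvx => <-; rewrite symR.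
  have [vy | nvy] := boolP (R v y); last first.
    by have := C_closed x y xC; rewrite !inE yX yv nvy xy => ->.
  by apply/orP; right; rewrite yX; apply/exists_inP; exists x; rewrite // symR.
have lift x : x \in C -> simplicial Y x -> simplicial X x.
  move=> xC [_ clx]; split; first exact: (subsetP CX).
  have nbhdE y : y \in nbhd X x -> y \in nbhd Y x.
    move=> yx; have := subsetP (nbhd_Y x xC) y yx.
    by rewrite !inE in yx * => ->; case/andP: yx.
  by move=> a b /nbhdE ax /nbhdE bx; apply: clx.
suff [x [xC sx]] : exists x, x \in C /\ simplicial Y x.
  by have [xv nvx] := Cv x xC; exists x; split=> //; apply: lift.
have good a b : a \in Y -> b \in Y -> b != a -> ~~ R a b ->
    {in S, forall s, s != a -> R a s} -> exists x, x \in C /\ simplicial Y x.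
  move=> aY bY ba nab aS.
  have [x [sx xa nax]] := IH Y a b Yn (chordal_onS YX chX) aY bY ba nab.
  exists x; split=> //; have [/setUP[//|/aS/(_ xa)]] := sx.
  by rewrite (negPf nax).
(* A vertex of [S] with a non-neighbour in [Y] is preferred; if there is none,
   then a vertex of [C] is adjacent to all of [S]. *)
have [/exists_inP[a aS /exists_inP[b bY /andP[ba nab]]] | noS] :=
    boolP [exists a in S, exists b in Y, (b != a) && ~~ R a b].
  apply: (good a b) => //; first by rewrite inE aS orbT.
  by move=> s sS sa; apply: S_clique; rewrite // eq_sym.
have [/exists_inP[a aY /exists_inP[b bY /andP[ba nab]]] | noY] :=
    boolP [exists a in Y, exists b in Y, (b != a) && ~~ R a b].
  apply: (good a b) => // s sS sa; apply: contraR noS => nas.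
  apply/exists_inP; exists s => //; apply/exists_inP; exists a => //.
  by rewrite eq_sym sa symR.
exists w; split=> //; split=> [|a b]; first by rewrite inE wC.
rewrite !inE => /andP[aY _] /andP[bY _] ab; apply: contraR noY => nab.
apply/exists_inP; exists a; rewrite ?inE //.
by apply/exists_inP; exists b; rewrite ?inE // eq_sym ab.
Qed.

(** Dirac's theorem; unless [X] is a clique, some vertex has a non-neighbour and
[nonneighbour_simplicial] applies. *)
Lemma chordal_simplicial X :
  chordal_on X -> X != set0 -> exists x, simplicial X x.
Proof.
move=> chX /set0Pn[v vX].
have [/exists_inP[a aX /exists_inP[b bX /andP[ba nab]]] | noX] :=
    boolP [exists a in X, exists b in X, (b != a) && ~~ R a b].
  have [x [sx _ _]] := nonneighbour_simplicial (leqnn _) chX aX bX ba nab.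
  by exists x.
exists v; split=> // a b; rewrite !inE => /andP[aX _] /andP[bX _] ab.
apply: contraR noX => nab; apply/exists_inP; exists a => //.
by apply/exists_inP; exists b; rewrite // eq_sym ab.
Qed.

End Simplicial.

(** * Clique trees of chordal graphs *)

Section Bags.

Variable T : finType.
Implicit Types (I P Q : {set {set T}}) (X S : {set T}) (u v x y : T).
Implicit Types (F H M : {set {set {set T}}}).

Definition bags_at I u : {set {set T}} := [set B in I | u \in B].

Lemma inside_pairs I F P : F \subset pairs I -> inside F P \subset pairs P.
Proof.
move=> /subsetP FI; apply/subsetP=> e; rewrite !inE => /andP[/FI].
by rewrite inE => /andP[-> _] ->.
Qed.

Lemma insideS F F' P Q :
  F \subset F' -> P \subset Q -> inside F P \subset inside F' Q.
Proof.
move=> /subsetP FF' PQ; apply/subsetP=> e; rewrite !inE => /andP[/FF' -> eP].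
exact: subset_trans eP PQ.
Qed.

Lemma inside_sub F P : inside F P \subset F.
Proof. by apply/subsetP=> e; rewrite inE => /andP[]. Qed.

Lemma insideI F P Q : inside F (P :&: Q) = inside F P :&: inside F Q.
Proof. by apply/setP=> e; rewrite !inE subsetI; case: (e \in F). Qed.

Lemma evens1 (B : {set T}) : evens [set B] = 0%VS.
Proof. by apply/eqP; rewrite -dimv_eq0 dim_evens cards1. Qed.

Section CliqueTree.
Variables (R : rel T) (symR : symmetric R) (irrR : irreflexive R).

Lemma clique_on_simplicial X x :
  simplicial R X x -> clique_on R (x |: nbhd R X x).
Proof.
case=> xX clx a b; rewrite !inE => /predU1P[-> | aN] /predU1P[-> | bN] ab.
- by rewrite eqxx in ab.
- by case/andP: bN.
- by rewrite symR; case/andP: aN.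
by apply: clx; rewrite // inE.
Qed.

Lemma simplicial_sub X x : simplicial R X x -> x |: nbhd R X x \subset X.
Proof.
case=> xX _; rewrite subUset sub1set xX.
by apply/subsetP=> y; rewrite inE => /andP[].
Qed.

(** Bags are arbitrary sets that cut out cliques of [X], so that both bags and
vertices can be deleted one at a time.  Let [x] be simplicial in [X] and
[q] a bag that contains [x] and its neighbours.  A further bag [i] containing [x]
satisfies [i :&: X \subset q], so it can be hung as a leaf on [q] in a forest for
the other bags.  If there is none, then [q] is the only bag at [x], and a forest
for [X :\ x] serves. *)
Lemma clique_tree n I X : #|I| + #|X| <= n -> chordal_on R X ->
    (forall B, B \in I -> clique_on R (B :&: X)) ->
    (forall S, S \subset X -> clique_on R S ->
       exists2 B, B \in I & S \subset B) ->
  exists F, [/\ F \subset pairs I, indep F & forall u, u \in X ->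
    (evens (bags_at I u) <= espan (inside F (bags_at I u)))%VS].
Proof.
elim: n I X => [|n IH] I X sz chX clI bagI.
  exists set0; split; [exact: sub0set | exact: indep0 |].
  move: sz; rewrite leqn0 addn_eq0 !cards_eq0 => /andP[_ /eqP->] u.
  by rewrite inE.
have [X0 | X0] := eqVneq X set0.
  exists set0; split; [exact: sub0set | exact: indep0 |].
  by move=> u; rewrite X0 inE.
have [x sx] := chordal_simplicial symR irrR chX X0.
have xX := proj1 sx.
have [q qI Sq] := bagI _ (simplicial_sub sx) (clique_on_simplicial sx).
have in_q i : i \in I -> x \in i -> i :&: X \subset q.
  move=> iI xi; apply: subset_trans Sq; apply/subsetP=> y yiX.
  rewrite !inE; have [//|yx /=] := eqVneq y x.
  have yX: y \in X by case/setIP: yiX.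
  by rewrite yX /= (clI i iI) // ?inE ?xi // eq_sym.
have [/exists_inP[i iI /andP[iq xi]] | only_q] :=
    boolP [exists i in I, (i != q) && (x \in i)].
  have [|B|S SX clS|F [FI iF Ftree]] := IH (I :\ i) X _ chX.
  - by move: sz; rewrite (cardsD1 i I) iI.
  - by rewrite inE => /andP[_ /clI].
  - have [B BI SB] := bagI S SX clS; have [Bi | Bi] := eqVneq B i.
      exists q; first by rewrite !inE eq_sym iq.
      by apply: subset_trans (in_q i iI xi); rewrite subsetI -{1}Bi SB.
    by exists B; rewrite // !inE Bi.
  exists ([set i; q] |: F); split.
  - rewrite subUset sub1set in_pairs iq iI qI /=.
    by apply: subset_trans FI _; apply: pairsS; apply: subsetDl.
  - apply: indepU1 => //; apply/negP.
    move=> /(subvP (espan_evens FI))/evensP[/(_ i) h _].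
    by move: h; rewrite ffunE !inE !eqxx /= => /(_ isT).
  move=> u uX; have Fu : (evens (bags_at (I :\ i) u) <=
      espan (inside ([set i; q] |: F) (bags_at I u)))%VS.
    apply: subv_trans (Ftree u uX) _; apply/espanS/insideS; first exact: subsetUr.
    by apply/subsetP=> B; rewrite !inE => /andP[/andP[_ ->]].
  have [ui | ui] := boolP (u \in i); last first.
    have I_eq : bags_at I u = bags_at (I :\ i) u.
      apply/setP=> B; rewrite !inE; case: eqVneq => // -> /=.
      by rewrite (negPf ui) andbF.
    by rewrite {1}I_eq.
  have uq: u \in q by apply: (subsetP (in_q i iI xi)); rewrite inE ui.
  set W := espan _ in Fu *.
  have toq a : a \in bags_at I u -> bd a q \in W.
    rewrite inE => /andP[aI ua]; have [-> | ai] := eqVneq a i.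
      apply: bd_in_espan.
      by rewrite !inE eqxx /= subUset !sub1set !inE iI ui qI uq.
    apply: (subvP Fu); apply: bd_in_evens; rewrite !inE ?ai ?aI //.
    by rewrite eq_sym iq qI.
  apply: evens_subv => a b aI bI.
  by rewrite -(bd_trans a q b) memvD // ?(bdC q) toq.
have chX' := chordal_onS (subsetDl X [set x]) chX.
have [|B BI|S SX clS|F [FI iF Ftree]] := IH I (X :\ x) _ chX'.
- by move: sz; rewrite (cardsD1 x X) xX addnS ltnS.
- move=> a b; rewrite !inE => /and3P[aB _ aX] /and3P[bB _ bX].
  by apply: (clI B BI); rewrite inE ?aB ?bB.
- by apply: bagI; rewrite // (subset_trans SX) ?subsetDl.
exists F; split=> // u uX.
have [-> | ux] := eqVneq u x; last by rewrite Ftree // !inE ux.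
suff -> : bags_at I x = [set q] by rewrite evens1 sub0v.
apply/setP=> B; rewrite !inE; apply/andP/eqP=> [[BI xB] | ->].
  by apply: contraNeq only_q => Bq; apply/exists_inP; exists B; rewrite // Bq.
by rewrite qI (subsetP Sq) // !inE eqxx.
Qed.

End CliqueTree.

(** * Weights of acyclic edge sets *)

Definition weight F := \sum_(e in F) edge_weight e.

(** An edge lies inside [bags_at I u] exactly for the [#|A :&: B|] vertices [u]
common to its two ends [A] and [B]. *)
Lemma weightE I F : F \subset pairs I ->
  weight F = \sum_u #|inside F (bags_at I u)|.
Proof.
move=> /subsetP FI; under [RHS]eq_bigr do rewrite -sum1_card.
rewrite (exchange_big_dep (mem F)) /=; last first.
  by move=> u e _; rewrite inE => /andP[].
apply: eq_bigr => e eF; rewrite sum1dep_card; apply: eq_card => u.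
have := FI e eF; rewrite !inE eF => /andP[_ /subsetP eI] /=.
apply/bigcapP/subsetP => ue B Be; first by rewrite inE eI ?ue.
by have := ue B Be; rewrite inE => /andP[].
Qed.

(** A forest on a nonempty set has fewer edges than vertices, by exactly one iff
it is a tree. *)
Lemma weight_leqif I F : F \subset pairs I ->
    (forall u, indep (inside F (bags_at I u))) ->
  weight F <= \sum_u #|bags_at I u|.-1 ?= iff
    [forall u, (evens (bags_at I u) <= espan (inside F (bags_at I u)))%VS].
Proof.
move=> FI iF; rewrite (weightE FI); apply: leqif_sum => u _.
rewrite -dim_evens -(eqP (iF u)); apply: dimv_leqif_sup.
by apply: espan_evens; apply: inside_pairs FI.
Qed.

Lemma weightU F H : [disjoint F & H] -> weight (F :|: H) = weight F + weight H.
Proof.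
move=> FH; rewrite /weight -bigU //.
by apply: eq_bigl => e; rewrite !inE.
Qed.

(** The binary number whose digits say which edges belong to [F]: a tie-breaker
for weights that is additive, hence compatible with exchanging parts of edge sets,
and injective. *)
Definition code F := \sum_(e in F) 2 ^ enum_rank e.

Lemma codeU F H : [disjoint F & H] -> code (F :|: H) = code F + code H.
Proof.
move=> FH; rewrite /code -bigU //.
by apply: eq_bigl => e; rewrite !inE.
Qed.

Lemma binary_inj n (b b' : nat -> bool) :
  \sum_(i < n) b i * 2 ^ i = \sum_(i < n) b' i * 2 ^ i ->
  forall i, i < n -> b i = b' i.
Proof.
elim: n b b' => // n IH b b'; rewrite !big_ord_recl !expn0 !muln1.
have split2 (c : nat -> bool) : \sum_(i < n) c (bump 0 i) * 2 ^ bump 0 i =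
    (\sum_(i < n) c i.+1 * 2 ^ i).*2.
  by rewrite -muln2 big_distrl; apply: eq_bigr => i _; rewrite expnSr mulnA.
rewrite !split2 => eq_bb'; have b0 : b 0 = b' 0.
  by have /(congr1 odd) := eq_bb'; rewrite !oddD !odd_double !addbF !oddb.
move: eq_bb'; rewrite b0 => /addnI/double_inj.
move/(IH (b \o succn) (b' \o succn)) => eqS.
by case=> [_|i /eqS].
Qed.

Lemma code_inj : injective code.
Proof.
pose bit F (i : nat) :=
  if insub i is Some j then enum_val (j : 'I_#|{: {set {set T}}}|) \in F
  else false.
have codeE F : code F = \sum_(i < #|{: {set {set T}}}|) bit F i * 2 ^ i.
  rewrite /code (reindex (fun i : 'I_#|{: {set {set T}}}| => enum_val i)) /=;
    last first.
    by apply: onW_bij; apply: enum_val_bij.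
  rewrite big_mkcond /=; apply: eq_bigr => i _.
  by rewrite enum_valK /bit valK; case: (_ \in F); rewrite ?mul1n ?mul0n.
move=> F H; rewrite !codeE => /binary_inj eqb; apply/setP=> e.
have := eqb _ (ltn_ord (enum_rank e)).
by rewrite /bit valK enum_rankK.
Qed.

Lemma best_set (feasible : pred {set {set {set T}}}) F0 : feasible F0 ->
  exists M, feasible M /\ forall F, feasible F ->
    weight F <= weight M /\ (weight F = weight M -> code F <= code M).
Proof.
move=> fF0; case: (arg_maxnP weight fF0) => M1 fM1 M1max.
have fM1' : feasible M1 && (weight M1 == weight M1) by rewrite fM1 /=.
pose heaviest F := feasible F && (weight F == weight M1).
case: (@arg_maxnP _ M1 heaviest code fM1') => M /andP[fM /eqP wM] Mmax.
exists M; split=> // F fF.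
rewrite wM; split=> [|wF]; first exact: M1max.
by apply: Mmax; rewrite /heaviest fF wF /=.
Qed.

(** * Gluing the heaviest local trees *)

(** The exchange spans at least what [M] spans, with no more edges. *)
Lemma swap_indep M P F : indep M ->
    (espan (inside M P) <= espan F)%VS -> #|F| <= #|inside M P| ->
  indep ((M :\: inside M P) :|: F).
Proof.
move=> iM spF cF; have MPM := inside_sub M P.
rewrite /indep eqn_leq dim_espan /=; apply: (@leq_trans #|M|).
  apply: leq_trans (leq_card_setU _ _) _; rewrite cardsD (setIidPr MPM).
  by rewrite -[leqRHS](subnK (subset_leq_card MPM)) leq_add2l.
rewrite -(eqP iM) dimvS // {1}(setU_D MPM) !espanU addvC.
by apply: addvS; [exact: subvv | exact: spF].
Qed.

(** Each [bags_at I v] carries a clique tree by hypothesis.  Hence the independent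
set [M v] of maximum weight, and of maximum code among those, attains the bound of
[weight_leqif], so it is a clique tree too.  Put
[P := bags_at I v :&: bags_at I u].  Both [M u] and [M v] restrict to spanning
trees on [P], so either restriction may replace the other without losing
independence; maximality of both makes their weights and codes equal, hence the
restrictions equal. *)
Lemma glue_trees I (V : {set T}) :
    {in V, forall v, exists F, [/\ F \subset pairs (bags_at I v), indep F &
      forall u, (evens (bags_at (bags_at I v) u) <=
        espan (inside F (bags_at (bags_at I v) u)))%VS]} ->
  exists H,
    [/\ forall e, e \in H -> exists2 v, v \in V & e \in pairs (bags_at I v),
    {in V, forall v, indep (inside H (bags_at I v))} &
    {in V &, forall u v, (evens (bags_at I u :&: bags_at I v) <=
      espan (inside H (bags_at I u :&: bags_at I v)))%VS}].
Proof.
move=> trees.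
have bags2 u v : bags_at (bags_at I v) u = bags_at I v :&: bags_at I u.
  by apply/setP=> B; rewrite !inE; case: (B \in I).
pose feasible v F := (F \subset pairs (bags_at I v)) && indep F.
have feas0 v : feasible v set0 by rewrite /feasible sub0set indep0.
have [M Mbest] := fin_all_exists (fun v => best_set (feas0 v)).
have Mpairs v : M v \subset pairs (bags_at I v) by case: (Mbest v) => /andP[].
have Mindep v : indep (M v) by case: (Mbest v) => /andP[].
have Mmax v F : F \subset pairs (bags_at I v) -> indep F ->
    weight F <= weight (M v) /\ (weight F = weight (M v) -> code F <= code (M v)).
  by move=> FI iF; apply: (proj2 (Mbest v)); rewrite /feasible FI.
(* Equality with the weight bound makes [M v] connected at every vertex. *)
have Mtree : {in V &, forall v u, (evens (bags_at I v :&: bags_at I u) <=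
    espan (inside (M v) (bags_at I v :&: bags_at I u)))%VS}.
  move=> v u vV uV; have [F [FI iF Ftree]] := trees v vV.
  have insI F' P : indep F' -> indep (inside F' P) := indepS (inside_sub F' P).
  have FW := weight_leqif FI (fun u' => insI F _ iF).
  have MW := weight_leqif (Mpairs v) (fun u' => insI _ _ (Mindep v)).
  have wF := FW.2; rewrite (introT forallP Ftree) in wF.
  have: weight (M v) == \sum_u' #|bags_at (bags_at I v) u'|.-1.
    by rewrite eqn_leq MW.1 -(eqP wF); case: (Mmax v F FI iF).
  by rewrite MW.2 => /forallP/(_ u); rewrite bags2.
have Mcap v P : indep (inside (M v) P) := indepS (inside_sub _ _) (Mindep v).
have card_cap v u : v \in V -> u \in V ->
    #|inside (M v) (bags_at I v :&: bags_at I u)| =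
      \dim (evens (bags_at I v :&: bags_at I u)).
  move=> vV uV; rewrite -(eqP (Mcap v _)); apply/eqP; rewrite eqn_leq.
  apply/andP; split.
    by apply/dimvS/espan_evens/(inside_pairs _ (Mpairs v)).
  by apply/dimvS/Mtree.
have agree_le v u : v \in V -> u \in V -> let P := bags_at I v :&: bags_at I u in
    weight (inside (M u) P) <= weight (inside (M v) P) /\
    (weight (inside (M u) P) = weight (inside (M v) P) ->
     code (inside (M u) P) <= code (inside (M v) P)).
  move=> vV uV P; set Fu := inside (M u) P; set Fv := inside (M v) P.
  have FuP : Fu \subset pairs P by apply: inside_pairs (Mpairs u).
  have FvP : Fv \subset pairs P by apply: inside_pairs (Mpairs v).
  have Fv_M : Fv \subset M v by apply: inside_sub.
  have disj F : F \subset pairs P -> [disjoint M v :\: Fv & F].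
    move=> /subsetP FP; apply/pred0P => e /=; rewrite !inE.
    apply/negP=> /andP[/andP[nF eM] /FP]; rewrite inE => /andP[_ eP].
    by rewrite eM eP in nF.
  have Mv_split : M v = (M v :\: Fv) :|: Fv by rewrite setUC -setU_D.
  have swap_pairs : (M v :\: Fv) :|: Fu \subset pairs (bags_at I v).
    rewrite subUset (subset_trans (subsetDl _ _) (Mpairs v)).
    by apply: subset_trans FuP (pairsS _); apply: subsetIl.
  have spvu : (espan Fv <= espan Fu)%VS.
    by apply: subv_trans (espan_evens FvP) _; rewrite /Fu /P setIC Mtree.
  have card_vu : #|Fu| <= #|Fv| by rewrite /Fv card_cap // /Fu /P setIC card_cap.
  have [] := Mmax v _ swap_pairs (swap_indep (Mindep v) spvu card_vu).
  rewrite weightU ?disj // codeU ?disj //.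
  have -> : weight (M v) = weight (M v :\: Fv) + weight Fv.
    by rewrite {1}Mv_split weightU ?disj.
  have -> : code (M v) = code (M v :\: Fv) + code Fv.
    by rewrite {1}Mv_split codeU ?disj.
  by rewrite !leq_add2l => wle cle; split=> // weq; apply: cle; rewrite weq.
have agree v u : v \in V -> u \in V ->
    inside (M u) (bags_at I v :&: bags_at I u) =
      inside (M v) (bags_at I v :&: bags_at I u).
  move=> vV uV; have [] := agree_le v u vV uV; have [] := agree_le u v uV vV.
  rewrite (setIC (bags_at I u)) => w1 c1 w2 c2.
  have weq := anti_leq (introT andP (conj w1 w2)).
  by apply: code_inj; apply: anti_leq; rewrite c1 // c2.
pose H := \bigcup_(v in V) M v.
have HM v : v \in V -> inside H (bags_at I v) = M v.
  move=> vV; apply/setP=> e; rewrite inE.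
  apply/andP/idP => [[/bigcupP[u uV eM] ev] | eM].
    have: e \in inside (M u) (bags_at I v :&: bags_at I u).
      have := subsetP (Mpairs u) e eM.
      by rewrite !inE eM subsetI ev => /andP[_ ->].
    by rewrite agree // inE => /andP[].
  split; first by apply/bigcupP; exists v.
  by have := subsetP (Mpairs v) e eM; rewrite inE => /andP[].
exists H; split.
- by move=> e /bigcupP[v vV /(subsetP (Mpairs v))]; exists v.
- by move=> v vV; rewrite HM.
move=> u v uV vV; apply: subv_trans (Mtree u v uV vV) _.
by apply/espanS/insideS => //; rewrite -(HM u uV) inside_sub.
Qed.

(** * Acyclicity along an elimination order *)

(** The new piece at a simplicial vertex [x] meets each earlier piece in a
connected graph, and all nonempty ones of these contain the bag [q] that covers
[x] and its neighbours; so it is glued along a connected graph. *)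
Lemma indep_bigcup (R : rel T) I H n X : #|X| <= n -> H \subset pairs I ->
    symmetric R -> irreflexive R -> chordal_on R X ->
    (forall S, S \subset X -> clique_on R S ->
       exists2 B, B \in I & S \subset B) ->
    {in X, forall x, indep (inside H (bags_at I x))} ->
    {in X &, forall x y,
      x != y -> bags_at I x :&: bags_at I y != set0 -> R x y} ->
    {in X &, forall x y, (evens (bags_at I x :&: bags_at I y) <=
      espan (inside H (bags_at I x :&: bags_at I y)))%VS} ->
  indep (\bigcup_(x in X) inside H (bags_at I x)).
Proof.
move=> Xn HI symR irrR; elim: n X Xn => [|n IH] X Xn chX bagI iH adjI evI.
  by move: Xn; rewrite leqn0 cards_eq0 => /eqP ->; rewrite big_set0 indep0.
have [-> | X0] := eqVneq X set0; first by rewrite big_set0 indep0.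
have [x sx] := chordal_simplicial symR irrR chX X0.
have xX := proj1 sx; have sD := subsetDl X [set x].
have [q qI Sq] := bagI _ (simplicial_sub sx) (clique_on_simplicial symR sx).
have xq: q \in bags_at I x by rewrite inE qI (subsetP Sq) // !inE eqxx.
rewrite (big_setD1 x xX) /=; set A := inside H _; set B := \bigcup_(y in _) _.
have hB : B \subset pairs (\bigcup_(y in X :\ x) bags_at I y).
  apply/bigcupsP => y yX; apply: subset_trans (inside_pairs _ HI) (pairsS _).
  exact: bigcup_sup.
apply: (indepU (inside_pairs _ HI) hB (iH x xX)).
  apply: IH.
  - by move: Xn; rewrite (cardsD1 x X) xX.
  - exact: chordal_onS sD chX.
  - by move=> S SX; apply: bagI; apply: subset_trans SX sD.
  - by move=> z zX; apply/iH/(subsetP sD).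
  - by move=> y z yX zX; apply: adjI; apply: (subsetP sD).
  - by move=> y z yX zX; apply: evI; apply: (subsetP sD).
rewrite big_distrr /=; apply: (@evens_bigcup _ _ _ _ q) => y yX.
  rewrite orbC; case: eqVneq => //= xy0; rewrite inE xq inE qI /=.
  apply: (subsetP Sq); have [yx yX'] := setD1P yX.
  by rewrite !inE (negPf yx) yX' adjI // eq_sym.
have [yx yX'] := setD1P yX; apply: subv_trans (evI x y xX yX') _.
by apply: espanS; rewrite insideI setIS // /B; apply: (bigcup_sup y).
Qed.

End Bags.

(** * Balls and short cycles *)

Section LocallyChordal.

Variables (T : finType) (G : sgraph T).
Implicit Types (v x y u : T) (X S : {set T}) (H : sgraph {set T}).

Lemma adj_sym : symmetric (adj G).
Proof. by move=> x y; rewrite /adj setUC. Qed.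

Lemma adj_irr : irreflexive (adj G).
Proof. by move=> x; apply/negP=> /card_edge; rewrite setUid cards1. Qed.

Lemma dist_path v p : path (adj G) v p ->
  exists2 d, dist G v (last v p) = Some d & d <= size p.
Proof.
move=> vp; have wp : walk G v (last v p) (size p).
  by apply/existsP; exists (in_tuple p); rewrite vp eqxx.
have con : connect (adj G) v (last v p) by apply/connectP; exists p.
case def_d: (dist G v (last v p)) => [d|]; last first.
  by move: def_d; rewrite /dist; case: {-}_ / idP.
by exists d => //; apply: (proj2 (dist_spec def_d)).
Qed.

Lemma ball_adj r v x y d d' : adj G x y -> dist G v x = Some d ->
  dist G v y = Some d' -> d + d' < r -> adj (ball G r v) x y.
Proof.
move=> xy dx dy dr; rewrite /adj inE [_ \in edges G]xy /=.
apply/existsP; exists x; apply/existsP; exists y.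
by rewrite eqxx /dist_sum_lt dx dy.
Qed.

Lemma ball_chord r v c : chordal (ball G r v) -> uniq c ->
    cycle (adj (ball G r v)) c -> 4 <= size c ->
  exists x y, [/\ x \in c, y \in c, adj G x y, y != next c x & x != next c y].
Proof.
move=> chv uc cc c4; have [|x [y [xc yc xy yx xy']]] := chv c _ c4.
  by rewrite /is_cycle uc cc (ltnW c4).
by exists x, y; split=> //; move: xy; rewrite /adj inE => /andP[].
Qed.

(** Distances to [v] are at most 1 here, so all edges belong to the ball as soon
as [2 < r]. *)
Lemma nbhd_chordal r v : 3 <= r -> chordal (ball G r v) ->
  chordal_on (adj G) (v |: nbhd (adj G) (verts G) v).
Proof.
move=> r3 chv c uc cc cX; apply: ball_chord chv uc _.
have dist1 x : x \in v |: nbhd (adj G) (verts G) v ->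
    exists2 d, dist G v x = Some d & d <= 1.
  rewrite !inE => /predU1P[-> | /andP[_ vx]].
    by have [//|d dv d0] := @dist_path v [::]; exists d => //; apply: leqW.
  by have [|d dv d1] := @dist_path v [:: x]; [rewrite /= vx | exists d].
apply: (@sub_in_cycle _ (mem (v |: nbhd (adj G) (verts G) v)) (adj G)) cc.
  move=> x y /dist1[d dx d1] /dist1[d' dy d1'] xy.
  apply: (ball_adj xy dx dy); apply: leq_trans r3.
  by rewrite ltnS (leq_add d1 d1').
by apply/allP=> x /cX.
Qed.

(** The start of the step [i] is within distance [i] of [v], walking back, and its
end within [size p - i.+1], walking on; these add up to less than [size p]. *)
Lemma closed_walk_ball r v p : path (adj G) v p -> last v p = v ->
  size p <= r -> path (adj (ball G r v)) v p.
Proof.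
move=> vp pv pr; apply/(pathP v) => i ip.
have adj_i := pathP v vp i ip.
have [d di d_le] : exists2 d, dist G v (nth v (v :: p) i) = Some d & d <= i.
  have [|d] := @dist_path v (take i p).
    by move: vp; rewrite -{1}(cat_take_drop i p) cat_path => /andP[].
  rewrite (last_nth v) (size_takel (ltnW ip)) => dd d_le; exists d => //.
  by rewrite -dd; case: (i) => //= k; rewrite nth_take.
have [d' di' d'_le] :
    exists2 d, dist G v (nth v p i) = Some d & d <= size p - i.+1.
  have Dp : drop i p = nth v p i :: drop i.+1 p by rewrite (drop_nth v ip).
  have := vp; rewrite -{1}(cat_take_drop i p) cat_path Dp /= => /and3P[_ _].
  have lastD : last (nth v p i) (drop i.+1 p) = v.
    by move: pv; rewrite -{1}(cat_take_drop i p) last_cat Dp.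
  move: (nth v p i) lastD => w lastD; rewrite -rev_path lastD.
  rewrite (eq_path (e' := adj G)) => [/dist_path[d0]|a b]; last exact: adj_sym.
  rewrite size_rev size_belast size_drop => dd d_le'; exists d0 => //.
  rewrite -dd; case: (drop i.+1 p) lastD => [/= <- //|a s] _.
  by rewrite /= rev_cons last_rcons.
apply: (ball_adj adj_i di di'); apply: leq_trans pr.
by apply: (@leq_ltn_trans (i + (size p - i.+1))); [apply: leq_add | lia].
Qed.

Lemma small_chordal r X : locally_chordal r G -> X \subset verts G -> #|X| <= r ->
  chordal_on (adj G) X.
Proof.
move=> chG /subsetP XG Xr c uc cc cX c4.
case: c uc cc cX c4 => [//|v p] uc cc cX c4.
have vG : v \in verts G by apply/XG/cX/mem_head.
apply: (ball_chord (chG v vG)) => //=.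
apply: closed_walk_ball; rewrite ?last_rcons //.
rewrite size_rcons; apply: leq_trans Xr; rewrite cardE.
by apply: (uniq_leq_size uc) => x /cX; rewrite mem_enum.
Qed.

End LocallyChordal.

(** * Clique graphs of locally chordal graphs *)

Section CliqueGraphs.

Variables (T : finType) (G : sgraph T).
Implicit Types (v x y u : T) (X S : {set T}) (H : sgraph {set T}).

Local Notation KG := (max_cliques G).
Local Notation K := (bags_at (max_cliques G)).
Local Notation R := (adj G).

Lemma max_clique_sub B : B \in KG -> B \subset verts G.
Proof. by rewrite inE => /maxsetp/andP[]. Qed.

Lemma max_clique_clique B : B \in KG -> clique_on R B.
Proof.
rewrite inE => /maxsetp/andP[_ /forall_inP cl] x y xB yB xy.
by have /forall_inP/(_ y yB)/implyP := cl x xB; apply.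
Qed.

Lemma clique_extend S : S \subset verts G -> clique_on R S ->
  exists2 B, B \in KG & S \subset B.
Proof.
move=> SG clS; have cS : is_clique G S.
  rewrite /is_clique SG; apply/forall_inP => x xS; apply/forall_inP => y yS.
  by apply/implyP; apply: clS.
by have [B maxB SB] := maxset_exists cS; exists B; rewrite ?inE.
Qed.

Lemma max_cliques_at_neq0 v : v \in verts G -> K v != set0.
Proof.
move=> vG; have [||B BK vB] := @clique_extend [set v].
- by rewrite sub1set.
- by move=> x y /set1P-> /set1P->; rewrite eqxx.
by apply/set0Pn; exists B; rewrite inE BK -sub1set.
Qed.

Lemma max_cliques_at_eq0 v : v \notin verts G -> K v = set0.
Proof.
move=> vG; apply/setP=> B; rewrite !inE; apply: contraNF vG => /andP[BK vB].
by apply: (subsetP (max_clique_sub _)) vB; rewrite inE.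
Qed.

Lemma common_clique_adj x y : x != y -> K x :&: K y != set0 -> R x y.
Proof.
move=> xy /set0Pn[B]; rewrite !inE => /andP[/andP[BK xB] /andP[_ yB]].
by apply: (@max_clique_clique B) => //; rewrite inE.
Qed.

Lemma edges_pairs H : subgraph H (clique_intersection_graph G) ->
  edges H \subset pairs KG.
Proof.
move=> [_ /subsetP HK]; apply/subsetP=> e /HK eK.
have /forall_inP/(_ e eK) := edges_wf (clique_intersection_graph G).
by rewrite inE.
Qed.

Lemma excess_sum : Posz (\sum_u #|K u|.-1) = clique_excess G.
Proof.
have count : \sum_(B in KG) #|B| = \sum_u #|K u|.
  under eq_bigr do rewrite -sum1_card.
  rewrite (exchange_big_dep predT) //=; apply: eq_bigr => u _.
  by rewrite sum1dep_card; apply: eq_card => B; rewrite !inE.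
have split_sum : \sum_u #|K u| = \sum_u #|K u|.-1 + #|verts G|.
  rewrite -sum1_card [X in _ + X]big_mkcond -big_split /=; apply: eq_bigr => u _.
  have [/max_cliques_at_neq0 | /max_cliques_at_eq0 ->] := boolP (u \in verts G).
    by rewrite -cards_eq0 -lt0n addn1 => /prednK.
  by rewrite cards0.
by rewrite /clique_excess count split_sum PoszD addrK.
Qed.

Lemma k_acyclicP k H : k_acyclic_spanning G k H <->
  spanning_subgraph H (clique_intersection_graph G) /\
  forall X, X \subset verts G -> #|X| <= k ->
    indep (\bigcup_(x in X) inside (edges H) (K x)).
Proof.
split=> -[sH acH]; split=> // X XG Xk.
  exact: (acyclic_indep (acH X XG Xk)).
exact: (@indep_acyclic _ (bigunion X (at_vertex G H)) (acH X XG Xk)).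
Qed.

Lemma clique_graphP H : clique_graph G H <->
  spanning_subgraph H (clique_intersection_graph G) /\
  {in verts G, forall v, (evens (K v) <= espan (inside (edges H) (K v)))%VS}.
Proof.
have vE v : spanning_subgraph H (clique_intersection_graph G) ->
    verts (at_vertex G H v) = K v.
  move=> [_ HK]; rewrite [LHS]/= HK; apply: (setIidPr (A := KG) (B := K v) _).
  by apply/subsetP=> B; rewrite inE => /andP[].
split=> -[sH conH]; split=> // v vG.
  have [_] := conH v vG; rewrite vE //.
  exact: (connect_evens (G := at_vertex G H v)).
rewrite /graph_connected vE //; split; first exact: max_cliques_at_neq0.
exact: (@evens_connect _ (at_vertex G H v) _ (conH v vG)).
Qed.

Lemma acyclic_at H k u :
  0 < k -> k_acyclic_spanning G k H -> indep (inside (edges H) (K u)).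
Proof.
move=> k0 /k_acyclicP[sH acH]; have [uG | uG] := boolP (u \in verts G).
  by have := acH [set u]; rewrite big_set1 cards1 sub1set; apply.
(* Outside [G] only the empty set could be an edge. *)
rewrite max_cliques_at_eq0 // (_ : inside _ _ = set0) ?indep0 //.
apply/setP=> e; rewrite !inE subset0; apply/andP=> -[/card_edge e2 /eqP e0].
by rewrite e0 cards0 in e2.
Qed.

Lemma acyclic_weight H k : 0 < k -> k_acyclic_spanning G k H ->
  total_weight H <= \sum_u #|K u|.-1 ?= iff
    [forall u, (evens (K u) <= espan (inside (edges H) (K u)))%VS].
Proof.
move=> k0 acH; apply: weight_leqif => [|u]; last exact: acyclic_at k0 acH.
by apply: edges_pairs; case: acH => -[].
Qed.

Lemma clique_graph_weight H k : 0 < k -> k_acyclic_spanning G k H ->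
  clique_graph G H <-> Posz (total_weight H) = clique_excess G.
Proof.
move=> k0 acH; rewrite -excess_sum; have wH := acyclic_weight k0 acH.
split=> [/clique_graphP[_ cH] | [wE]].
  congr Posz; apply/eqP; rewrite wH.2; apply/forallP=> u.
  have [/cH // | /max_cliques_at_eq0 ->] := boolP (u \in verts G).
  by apply: evens_subv => x y; rewrite inE.
apply/clique_graphP; split=> [|v vG]; first by case: acH.
by have := wH.2; rewrite wE eqxx => /esym/forallP.
Qed.

(** The bags at [v] cover every clique in the closed neighbourhood of [v], as [v]
can be added to it. *)
Lemma local_clique_tree r v : 3 <= r -> locally_chordal r G -> v \in verts G ->
  exists F : {set {set {set T}}}, [/\ F \subset pairs (K v), indep F & forall u,
    (evens (bags_at (K v) u) <= espan (inside F (bags_at (K v) u)))%VS].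
Proof.
move=> r3 chG vG; set X := v |: nbhd R (verts G) v.
have XG : X \subset verts G.
  by rewrite subUset sub1set vG; apply/subsetP=> x; rewrite inE => /andP[].
have chX : chordal_on R X := nbhd_chordal r3 (chG v vG).
have [||F [FK iF Ftree]] :=
    clique_tree (@adj_sym _ G) (@adj_irr _ G) (leqnn (#|K v| + #|X|)) chX.
- move=> B; rewrite inE => /andP[BK _] x y /setIP[xB _] /setIP[yB _].
  exact: (max_clique_clique BK).
- move=> S SX clS; have [||B BK vSB] := @clique_extend (v |: S).
  + by rewrite subUset sub1set vG (subset_trans SX).
  + have vS x : x \in S -> x != v -> R v x.
      move=> /(subsetP SX); rewrite !inE.
      by case/predU1P=> [->|/andP[]]; rewrite ?eqxx.
    move=> x y; rewrite !inE => /predU1P[-> | xS] /predU1P[-> | yS] xy.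
    - by rewrite eqxx in xy.
    - by apply: vS; rewrite // eq_sym.
    - by rewrite adj_sym; apply: vS.
    by apply: clS.
  move: vSB; rewrite subUset sub1set => /andP[vB SB].
  by exists B; rewrite // inE BK.
exists F; split=> // u; have [/Ftree // | uX] := boolP (u \in X).
rewrite (_ : bags_at _ u = set0).
  by apply: evens_subv => x y; rewrite inE.
apply/setP=> B; rewrite !inE; apply: contraNF uX => /andP[/andP[BK vB] uB].
have BK' : B \in KG by rewrite inE.
rewrite !inE (subsetP (max_clique_sub BK')) //=; case: eqVneq => //= uv.
by apply: (max_clique_clique BK'); rewrite // eq_sym.
Qed.

Lemma chordal_on_le2 X : #|X| <= 2 -> chordal_on R X.
Proof.
move=> X2 c uc _ cX c4; have := uniq_leq_size uc (s2 := enum X).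
rewrite -cardE => /(_ _) cX2; have: size c <= 2.
  by apply: leq_trans (cX2 _) X2 => x /cX; rewrite mem_enum.
by move=> c2; have := leq_trans c4 c2.
Qed.

Lemma indep_union_at (E : {set {set {set T}}}) X : E \subset pairs KG ->
    X \subset verts G -> chordal_on R X ->
    {in X, forall x, indep (inside E (K x))} ->
    {in X &, forall x y,
      (evens (K x :&: K y) <= espan (inside E (K x :&: K y)))%VS} ->
  indep (\bigcup_(x in X) inside E (K x)).
Proof.
move=> EK XG chX iE evE.
apply: (indep_bigcup (leqnn _) EK (@adj_sym _ G) (@adj_irr _ G) chX) => //.
  by move=> S SX; apply: clique_extend; apply: subset_trans SX XG.
by move=> x y _ _; apply: common_clique_adj.
Qed.

(** The graph glued from the heaviest local trees has trees at all vertices, any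
two of which meet in a tree; [indep_union_at] applies to it because a graph on at
most two vertices is chordal. *)
Lemma exists_2acyclic_clique_graph r : 3 <= r -> locally_chordal r G ->
  exists2 H, k_acyclic_spanning G 2 H & clique_graph G H.
Proof.
move=> r3 chG.
have [E [EK iE evE]] := glue_trees (fun v => @local_clique_tree r v r3 chG).
have EKG e : e \in E -> e \in edges (clique_intersection_graph G).
  case/EK=> v vG /pairsP[A [B [AB]]].
  rewrite !inE => /andP[AK vA] /andP[BK vB] ->.
  apply/exists_inP; exists A; rewrite ?inE //.
  apply/exists_inP; exists B; rewrite ?inE //.
  by rewrite AB eqxx andbT; apply/set0Pn; exists v; rewrite inE vA.
have wfE : [forall e in E, (#|e| == 2) && (e \subset KG)].
  apply/forall_inP => e /EKG.
  exact: (forall_inP (edges_wf (clique_intersection_graph G))).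
pose H := SGraph wfE.
have sH : spanning_subgraph H (clique_intersection_graph G).
  by do 2?split=> //=; apply/subsetP.
exists H.
  apply/k_acyclicP; split=> // X XG X2.
  apply: (indep_union_at (edges_pairs sH.1) XG).
  - exact: chordal_on_le2.
  - by move=> x /(subsetP XG)/iE.
  by move=> x y /(subsetP XG) xG /(subsetP XG) yG; apply: evE.
apply/clique_graphP; split=> // v vG.
by have := evE v v vG vG; rewrite setIid.
Qed.

(** Being 2-acyclic makes the trees at any two vertices meet in a tree
([evens_espan_capv]), and [X] is chordal by [small_chordal]. *)
Lemma clique_graph_r_acyclic r H : locally_chordal r G ->
  k_acyclic_spanning G 2 H -> clique_graph G H -> k_acyclic_spanning G r H.
Proof.
move=> chG acH /clique_graphP[sH cH]; apply/k_acyclicP; split=> // X XG Xr.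
apply: (indep_union_at (edges_pairs sH.1) XG (small_chordal chG XG Xr)).
  by move=> x _; apply: acyclic_at acH.
move=> x y /(subsetP XG) xG /(subsetP XG) yG; rewrite insideI.
apply: evens_espan_capv (cH x xG) (cH y yG).
have /k_acyclicP[_ /(_ [set x; y])] := acH.
rewrite subUset !sub1set xG yG => /(_ isT); rewrite cards2 => h.
apply: indepS (h _); last by case: (x != y).
by rewrite subUset (bigcup_sup x) ?(bigcup_sup y) // !inE eqxx ?orbT.
Qed.

End CliqueGraphs.

Theorem theorem10 (T : finType) (G : sgraph T) (r : nat)
    (hr : 3 <= r) (hG : locally_chordal r G)
    (H : sgraph {set T}) (hH : subgraph H (clique_intersection_graph G)) :
  ((k_acyclic_spanning G r H /\ clique_graph G H) <->
     max_weight_k_acyclic_spanning G 2 H) /\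
  (max_weight_k_acyclic_spanning G 2 H <->
     (k_acyclic_spanning G 2 H /\
      Posz (total_weight H) = clique_excess G)).
Proof.
have r_to_2 : k_acyclic_spanning G r H -> k_acyclic_spanning G 2 H.
  case=> sH acH; split=> // X XG X2; apply: acH XG (leq_trans X2 _).
  exact: ltnW hr.
have weightP : max_weight_k_acyclic_spanning G 2 H <->
    k_acyclic_spanning G 2 H /\ Posz (total_weight H) = clique_excess G.
  split=> -[ac2 wH]; split=> //.
    have [H0 ac0 cg0] := exists_2acyclic_clique_graph hr hG.
    have /(clique_graph_weight _ ac0) w0 := cg0.
    move: (w0 isT) (wH H0 ac0); rewrite -excess_sum => -[->] wle.
    congr Posz; apply/eqP; rewrite eqn_leq wle andbT.
    by have [] := acyclic_weight (ltn0Sn 1) ac2.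
  move=> H' ac'; move: wH; rewrite -excess_sum => -[->].
  by have [] := acyclic_weight (ltn0Sn 1) ac'.
split=> //; split=> [[acr cgH] | /weightP[ac2 wH]].
  apply/weightP; split; first exact: r_to_2.
  by apply/(clique_graph_weight _ (r_to_2 acr)).
have cgH : clique_graph G H by apply/(clique_graph_weight _ ac2).
by split=> //; apply: clique_graph_r_acyclic.
Qed.
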